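(* Let $k$ and $N$ be positive integers and let $f$ be a non-zero second order cusp form of weight $k$ and level $N$, with Fourier expansion $f(z)=\sum_{n\ge 1}a_ne^{2\pi inz}$. If the Fourier coefficients $a_n$ ($n\ge 1$) are real numbers, then they change signs infinitely often.
   Context: Let $\mathcal{H}$ be the upper half-plane, let $\Gamma_0(N)=\left\{\begin{pmatrix}a&b\\c&d\end{pmatrix}\in SL_2(\mathbb{Z}): N\mid c\right\}$, and let $S_k(N)$ be the space of (elliptic, holomorphic) cusp forms of weight $k$ on $\Gamma_0(N)$. For $f:\mathcal{H}\to\mathbb{C}$ and $\gamma=\begin{pmatrix}a&b\\c&d\end{pmatrix}\in\Gamma_0(N)$ put $$f|_k(\gamma-1)(z):=(cz+d)^{-k}f\left(\frac{az+b}{cz+d}\right)-f(z).$$ A holomorphic function $f:\mathcal{H}\to\mathbb{C}$ is called a second order cusp form of weight $k$ and level $N$ if: (a) $f|_k(\gamma-1)\in S_k(N)$ for all $\gamma\in\Gamma_0(N)$; (b) $f|_k(\pi-1)=0$ for all parabolic elements $\pi$ in $\Gamma_0(N)$; (c) $f$ has exponential decay at each cusp of $\Gamma_0(N)$. By (b) applied to $\begin{pmatrix}1&1\\0&1\end{pmatrix}$, and by (c), $f$ has a Fourier expansion of the form $\sum_{n\ge1}a_ne^{2\pi inz}$. A sequence of real numbers changes signs infinitely often if it has infinitely many strictly positive terms and infinitely many strictly negative terms. *)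

(* Defs.v *)
From Stdlib Require Import Reals ZArith.
From Coquelicot Require Import Coquelicot.

(* Functions on the upper half-plane are represented as total functions C -> C;
   every predicate below depends only on their values on [upper_half_plane]. *)
Definition upper_half_plane (z : C) : Prop := (0 < Im z)%R.

Definition holomorphic_on_H (f : C -> C) : Prop :=
  forall z : C, upper_half_plane z -> @ex_derive C_AbsRing C_NormedModule f z.

Definition Cexp (z : C) : C :=
  (RtoC (exp (Re z)) * (RtoC (cos (Im z)) + Ci * RtoC (sin (Im z))))%C.

(* The integer matrix (a b; c d). *)
Record mat2 : Set := Mat2 { ma : Z; mb : Z; mc : Z; md : Z }.

Definition in_SL2Z (g : mat2) : Prop := (ma g * md g - mb g * mc g = 1)%Z.

Definition in_Gamma0 (N : nat) (g : mat2) : Prop :=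
  in_SL2Z g /\ (Z.of_nat N | mc g)%Z.

Definition ZtoC (n : Z) : C := RtoC (IZR n).

Definition moebius (g : mat2) (z : C) : C :=
  ((ZtoC (ma g) * z + ZtoC (mb g)) / (ZtoC (mc g) * z + ZtoC (md g)))%C.

Definition slash (k : nat) (f : C -> C) (g : mat2) (z : C) : C :=
  (/ ((ZtoC (mc g) * z + ZtoC (md g)) ^ k) * f (moebius g z))%C.

(* f|_k(g - 1) *)
Definition slash_sub1 (k : nat) (f : C -> C) (g : mat2) (z : C) : C :=
  (slash k f g z - f z)%C.

(* Elements of trace -2 are included. *)
Definition parabolic (g : mat2) : Prop :=
  Z.abs (ma g + md g) = 2%Z /\ g <> Mat2 1 0 0 1 /\ g <> Mat2 (-1) 0 0 (-1).

(* Limit 0 as Im z tends to +oo, uniformly in Re z. *)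
Definition vanishes_at_i_infty (f : C -> C) : Prop :=
  forall eps : R, (0 < eps)%R ->
  exists Y : R, forall z : C, upper_half_plane z -> (Y <= Im z)%R ->
    (Cmod (f z) < eps)%R.

(* O(exp (- c Im z)) for some c > 0 as Im z tends to +oo, uniformly in Re z. *)
Definition exp_decay_at_i_infty (f : C -> C) : Prop :=
  exists c A Y : R, (0 < c)%R /\
  forall z : C, upper_half_plane z -> (Y <= Im z)%R ->
    (Cmod (f z) <= A * exp (- (c * Im z)))%R.

(* The cusps of Gamma0(N) are the points s(oo) with s in SL2(Z), and the
   behaviour of f at s(oo) is that of f|_k s at i oo.  Letting s range over all
   of SL2(Z) thus covers every cusp. *)
Definition cusp_form (k N : nat) (f : C -> C) : Prop :=
  holomorphic_on_H f /\
  (forall g : mat2, in_Gamma0 N g ->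
     forall z : C, upper_half_plane z -> slash k f g z = f z) /\
  (forall s : mat2, in_SL2Z s -> vanishes_at_i_infty (slash k f s)).

Definition second_order_cusp_form (k N : nat) (f : C -> C) : Prop :=
  holomorphic_on_H f /\
  (forall g : mat2, in_Gamma0 N g -> cusp_form k N (slash_sub1 k f g)) /\
  (forall p : mat2, in_Gamma0 N p -> parabolic p ->
     forall z : C, upper_half_plane z -> slash_sub1 k f p z = RtoC 0) /\
  (forall s : mat2, in_SL2Z s -> exp_decay_at_i_infty (slash k f s)).

(* f z = sum_(n >= 1) a n * exp (2 pi i n z) on the upper half-plane; the value
   [a 0] plays no role. *)
Definition has_fourier_expansion (f : C -> C) (a : nat -> C) : Prop :=
  forall z : C, upper_half_plane z ->
    @is_series C_AbsRing C_NormedModule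
      (fun n : nat =>
         (a (S n) * Cexp (RtoC (2 * PI) * Ci * RtoC (INR (S n)) * z))%C)
      (f z).

(* For a sequence indexed by n >= 1. *)
Definition changes_signs_infinitely_often (u : nat -> R) : Prop :=
  (forall M : nat, exists n : nat, (1 <= n)%nat /\ (M <= n)%nat /\ (0 < u n)%R) /\
  (forall M : nat, exists n : nat, (1 <= n)%nat /\ (M <= n)%nat /\ (u n < 0)%R).

(* Main.v *)
Require Import Defs.
From Stdlib Require Import Reals ZArith.
From Coquelicot Require Import Coquelicot.
From Stdlib Require Import Lra Lia Classical.

(** The idea is to follow [f] down the imaginary axis towards the
    cusp 0.  Put g(y) = Re f(iy) = sum_n Re(a_n) exp(-2 pi n y).  Exponential
    decay of [f] at the cusp 0 = S(oo), S = (0 -1; 1 0), says that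
    y^k |f(iy)| = O(exp(-c/y)), so g vanishes to infinite order as y tends to 0+
    ([flat_of_decay_at_cusp_0]).

    A flat Dirichlet series g(t) = sum_n c_n exp(-lam_n t), with lam strictly
    increasing and c_n >= 0 for n >= m, has c_n = 0 for all n >= m
    ([flat_nonneg_tail_vanishes]).  The reason: the operator
    g(t) |-> g(t) - exp(lam_j s) g(t + s) multiplies the n-th coefficient by
    1 - exp(-(lam_n - lam_j) s), which is zero for n = j and positive for n > j.
    Applied for j = 0, ..., m - 1 it removes the terms of unknown sign and leaves
    a series of nonnegative terms, each of which is therefore at most the sum.
    With s = t the sum is still flat in t, say O(t^(m+1)), while the surviving
    n-th term is at least a positive constant times c_n t^m; letting t tend to
    0+ gives c_n = 0.

    Once the tail vanishes, every coefficient does ([flat_one_signed_zero]): the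
    last one left has some sign, so together with the zeros after it it forms a
    tail of constant sign, and it vanishes in turn.

    If the a_n had only finitely many positive, or only finitely many negative,
    terms, they would all be zero, and so would f. *)

Local Open Scope R_scope.

(** * Sieving a flat Dirichlet series *)

Lemma exp_nondecreasing (x y : R) : x <= y -> exp x <= exp y.
Proof.
  intros [H| ->]; [apply Rlt_le, exp_increasing; exact H|lra].
Qed.

Definition flat_at_0 (g : R -> R) : Prop :=
  forall J : nat, exists K delta : R, 0 <= K /\ 0 < delta /\
  forall t : R, 0 < t <= delta -> Rabs (g t) <= K * t ^ J.

Definition dirichlet_expansion (lam c : nat -> R) (g : R -> R) : Prop :=
  forall t : R, 0 < t -> is_series (fun n => c n * exp (- (lam n * t))) (g t).

(** The composite of the operators g(t) |-> g(t) - exp(lam_j s) g(t + s) for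
    j < m; the j-th one annihilates exp(-lam_j t). *)
Fixpoint sieve (lam : nat -> R) (s : R) (m : nat) (g : R -> R) (t : R) : R :=
  match m with
  | O => g t
  | S m => sieve lam s m g t - exp (lam m * s) * sieve lam s m g (t + s)
  end.

(** The factor by which [sieve lam s m] multiplies the coefficient of a term
    of exponent [x]. *)
Fixpoint sieve_factor (lam : nat -> R) (s : R) (m : nat) (x : R) : R :=
  match m with
  | O => 1
  | S m => sieve_factor lam s m x * (1 - exp (- ((x - lam m) * s)))
  end.

Lemma sieve_series (lam c : nat -> R) (g : R -> R) (s : R) (m : nat) :
  dirichlet_expansion lam c g -> 0 < s ->
  dirichlet_expansion lam (fun n => c n * sieve_factor lam s m (lam n))
    (sieve lam s m g).
Proof.
  intros Hg Hs; induction m as [|m IH]; intros t Ht; simpl.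
  - eapply is_series_ext; [| exact (Hg t Ht)].
    intros n; simpl; ring.
  - assert (Hts : 0 < t + s) by lra.
    pose proof (is_series_minus _ _ _ _ (IH t Ht)
      (is_series_scal_l (exp (lam m * s)) _ _ (IH (t + s) Hts))) as H.
    eapply is_series_ext; [| exact H].
    intros n; unfold minus, plus, opp, scal; simpl; unfold mult; simpl.
    replace (exp (- (lam n * (t + s))))
      with (exp (- ((lam n - lam m) * s)) * exp (- (lam n * t))
            * exp (- (lam m * s)))
      by (rewrite <- !exp_plus; f_equal; ring).
    assert (E : exp (lam m * s) * exp (- (lam m * s)) = 1)
      by (rewrite <- exp_plus, Rplus_opp_r; apply exp_0).
    set (p := exp (lam m * s)) in *; set (q := exp (- (lam m * s))) in *.
    set (e := exp (- ((lam n - lam m) * s))).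
    set (h := exp (- (lam n * t))).
    set (w := sieve_factor lam s m (lam n)).
    replace (c n * w * h + - (p * (c n * w * (e * h * q))))
      with (c n * w * h + - (c n * w * (e * h) * (p * q))) by ring.
    rewrite E; ring.
Qed.

Lemma sieve_factor_killed (lam : nat -> R) (s : R) (m n : nat) :
  (n < m)%nat -> sieve_factor lam s m (lam n) = 0.
Proof.
  induction m as [|m IH]; intros H; [lia|]; simpl.
  destruct (Nat.eq_dec n m) as [->|Hne].
  - replace (- ((lam m - lam m) * s)) with 0 by ring.
    rewrite exp_0; ring.
  - rewrite IH by lia; ring.
Qed.

(** Each of the [m] factors 1 - exp(-d s), d > 0, is of order s.  The constant
    [kappa] may depend on [n]: it is used for one term at a time. *)
Lemma sieve_factor_lower_bound (lam : nat -> R) (m n : nat) :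
  (forall i j, (i < j)%nat -> lam i < lam j) -> (m <= n)%nat ->
  exists kappa : R, 0 < kappa /\
  forall s : R, 0 < s <= 1 -> kappa * s ^ m <= sieve_factor lam s m (lam n).
Proof.
  intros Hlam; induction m as [|m IH]; intros Hmn.
  - exists 1; split; [lra|]; intros s _; simpl; lra.
  - destruct IH as [kappa [Hk H]]; [lia|].
    assert (Hd : 0 < lam n - lam m) by (assert (lam m < lam n) by (apply Hlam; lia); lra).
    set (d := lam n - lam m) in *.
    exists (kappa * (d * exp (- d))); split.
    + pose proof (exp_pos (- d)); repeat apply Rmult_lt_0_compat; lra.
    + intros s Hs; simpl.
      replace (kappa * (d * exp (- d)) * (s * s ^ m))
        with (kappa * s ^ m * (d * s * exp (- d))) by ring.
      pose proof (exp_pos (- d)) as Hpos.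
      assert (Hs0 : 0 < d * s) by (apply Rmult_lt_0_compat; lra).
      apply Rmult_le_compat.
      * apply Rmult_le_pos; [lra|apply pow_le; lra].
      * apply Rmult_le_pos; lra.
      * apply H; lra.
      * (* 1 - exp(-x) >= x exp(-x), from exp x >= 1 + x, and x = d s <= d *)
        fold d.
        assert (E : exp (d * s) * exp (- (d * s)) = 1)
          by (rewrite <- exp_plus, Rplus_opp_r; apply exp_0).
        pose proof (exp_ineq1_le (d * s)) as H1.
        pose proof (exp_pos (- (d * s))) as H2.
        assert (exp (- d) <= exp (- (d * s))).
        { apply exp_nondecreasing.
          assert (d * s <= d * 1) by (apply Rmult_le_compat_l; lra); lra. }
        apply Rle_trans with (d * s * exp (- (d * s))).
        { apply Rmult_le_compat_l; lra. }
        assert ((1 + d * s) * exp (- (d * s)) <= exp (d * s) * exp (- (d * s)))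
          by (apply Rmult_le_compat_r; lra).
        lra.
Qed.

(** The sieve evaluates [g] at t, t + s, ..., t + m s with coefficients that stay
    bounded for small s, so flatness survives.  The bound is uniform in [s], which
    allows s = t later. *)
Lemma sieve_flat (lam : nat -> R) (g : R -> R) (m J : nat) :
  flat_at_0 g ->
  exists K delta : R, 0 <= K /\ 0 < delta /\
  forall s t : R, 0 < s -> 0 < t -> t + INR m * s <= delta ->
    Rabs (sieve lam s m g t) <= K * (t + INR m * s) ^ J.
Proof.
  intros Hg; induction m as [|m IH].
  - destruct (Hg J) as [K [delta [HK [Hd H]]]].
    exists K, delta; repeat split; auto.
    intros s t Hs Ht; simpl; rewrite Rmult_0_l, Rplus_0_r; intros Hle.
    apply H; lra.
  - destruct IH as [K [delta [HK [Hd H]]]].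
    pose proof (exp_pos (Rabs (lam m) * delta)) as HE.
    exists (K + exp (Rabs (lam m) * delta) * K), delta; repeat split; auto.
    { pose proof (Rmult_le_pos _ _ (Rlt_le _ _ HE) HK); lra. }
    intros s t Hs Ht; rewrite S_INR; intros Hle; simpl sieve.
    pose proof (pos_INR m) as Hm.
    assert (Hms : 0 <= INR m * s) by (apply Rmult_le_pos; lra).
    replace (t + (INR m + 1) * s) with (t + s + INR m * s) in * by ring.
    assert (H1 := H s t Hs Ht ltac:(lra)).
    assert (H2 := H s (t + s) Hs ltac:(lra) ltac:(lra)).
    assert (Hpow : (t + INR m * s) ^ J <= (t + s + INR m * s) ^ J)
      by (apply pow_incr; lra).
    assert (Hexp : exp (lam m * s) <= exp (Rabs (lam m) * delta)).
    { apply exp_nondecreasing, Rle_trans with (Rabs (lam m) * s).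
      - apply Rmult_le_compat_r; [lra|apply Rle_abs].
      - apply Rmult_le_compat_l; [apply Rabs_pos|lra]. }
    unfold Rminus.
    eapply Rle_trans; [apply Rabs_triang|].
    rewrite Rabs_Ropp, Rabs_mult, (Rabs_pos_eq (exp _))
      by (apply Rlt_le, exp_pos).
    rewrite Rmult_plus_distr_r.
    apply Rplus_le_compat.
    + eapply Rle_trans; [exact H1|]; apply Rmult_le_compat_l; lra.
    + rewrite Rmult_assoc.
      apply Rmult_le_compat; auto using Rabs_pos, Rlt_le, exp_pos.
Qed.

Lemma series_nonneg_ge_term (u : nat -> R) (l : R) (n : nat) :
  (forall i, 0 <= u i) -> is_series u l -> u n <= l.
Proof.
  intros Hu Hl.
  apply Rle_trans with (sum_n u n).
  - destruct n as [|n]; [rewrite sum_O; lra|].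
    rewrite sum_Sn; unfold plus; simpl.
    assert (0 <= sum_n u n); [|lra].
    induction n as [|n IH]; [rewrite sum_O; apply Hu|].
    rewrite sum_Sn; unfold plus; simpl; specialize (Hu (S n)); lra.
  - apply (is_lim_seq_incr_compare (sum_n u) l Hl).
    intros i; rewrite sum_Sn; unfold plus; simpl; specialize (Hu (S i)); lra.
Qed.

(** Sieving out the first [m] terms with s = t leaves nonnegative terms, the n-th
    at least of order c_n t^m, whose sum is O(t^(m+1)). *)
Lemma flat_nonneg_tail_vanishes (lam c : nat -> R) (g : R -> R) (m : nat) :
  (forall i j, (i < j)%nat -> lam i < lam j) ->
  dirichlet_expansion lam c g -> flat_at_0 g ->
  (forall n, (m <= n)%nat -> 0 <= c n) ->
  forall n, (m <= n)%nat -> c n = 0.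
Proof.
  intros Hlam Hser Hflat Hc n Hn.
  destruct (sieve_factor_lower_bound lam m n Hlam Hn) as [kappa [Hk Hlow]].
  destruct (sieve_flat lam g m (S m) Hflat) as [K [delta [HK [Hd Hup]]]].
  (* With s = t, the sieve looks at g on [t, B t]. *)
  set (B := (1 + INR m)).
  assert (HB : 1 <= B) by (unfold B; pose proof (pos_INR m); lra).
  set (E := exp (- Rabs (lam n))).
  assert (HE : 0 < E) by apply exp_pos.
  assert (Hterm : forall t, 0 < t <= 1 -> t * B <= delta ->
    c n * (kappa * E) <= K * B ^ S m * t).
  { intros t Ht HtB.
    assert (Htm : 0 < t ^ m) by (apply pow_lt; lra).
    apply Rmult_le_reg_r with (t ^ m); auto.
    replace (K * B ^ S m * t * t ^ m) with (K * (t + INR m * t) ^ S m)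
      by (replace (t + INR m * t) with (B * t) by (unfold B; ring);
          rewrite Rpow_mult_distr; simpl; ring).
    eapply Rle_trans; [|apply (Hup t t); try lra; unfold B in HtB; lra].
    eapply Rle_trans; [|apply Rle_abs].
    eapply Rle_trans;
      [|apply (series_nonneg_ge_term _ _ n)
          with (2 := sieve_series lam c g t m Hser (proj1 Ht) t (proj1 Ht))].
    - assert (HEt : E <= exp (- (lam n * t))).
      { assert (lam n * t <= Rabs (lam n)).
        { rewrite <- (Rmult_1_r (Rabs (lam n))).
          apply Rle_trans with (Rabs (lam n) * t).
          - apply Rmult_le_compat_r; [lra|apply Rle_abs].
          - apply Rmult_le_compat_l; [apply Rabs_pos|lra]. }
        apply exp_nondecreasing; lra. }
      specialize (Hlow t Ht).
      replace (c n * (kappa * E) * t ^ m) with (c n * (kappa * t ^ m) * E)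
        by ring.
      assert (0 <= kappa * t ^ m) by (apply Rmult_le_pos; lra).
      specialize (Hc n Hn).
      apply Rmult_le_compat; try lra.
      + apply Rmult_le_pos; lra.
      + apply Rmult_le_compat_l; lra.
    - intros i; apply Rmult_le_pos; [|apply Rlt_le, exp_pos].
      destruct (Nat.lt_ge_cases i m) as [Hi|Hi].
      + rewrite sieve_factor_killed by exact Hi; lra.
      + apply Rmult_le_pos; [auto|].
        destruct (sieve_factor_lower_bound lam m i Hlam Hi) as [k' [Hk' Hl']].
        eapply Rle_trans; [|exact (Hl' t Ht)].
        apply Rmult_le_pos; lra. }
  (* If c_n > 0, [Hterm] bounds a positive constant P by Q t for all small t;
     take t so small that (Q + 1) t <= P / 2. *)
  specialize (Hc n Hn).
  destruct (Req_dec (c n) 0) as [|Hne]; [assumption|exfalso].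
  set (P := c n * (kappa * E)) in *.
  assert (HP : 0 < P)
    by (unfold P; repeat apply Rmult_lt_0_compat; lra).
  set (Q := K * B ^ S m) in *.
  assert (HQ : 0 <= Q)
    by (unfold Q; apply Rmult_le_pos; [lra|apply pow_le; lra]).
  set (t := Rmin (Rmin 1 (delta / B)) (P / (2 * (Q + 1)))).
  assert (HdB : 0 < delta / B) by (apply Rdiv_lt_0_compat; lra).
  assert (HPQ : 0 < P / (2 * (Q + 1))) by (apply Rdiv_lt_0_compat; lra).
  assert (Ht0 : 0 < t) by (unfold t; repeat apply Rmin_glb_lt; lra).
  pose proof (Rmin_l (Rmin 1 (delta / B)) (P / (2 * (Q + 1)))) as T1.
  pose proof (Rmin_r (Rmin 1 (delta / B)) (P / (2 * (Q + 1)))) as T2.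
  pose proof (Rmin_l 1 (delta / B)) as T3.
  pose proof (Rmin_r 1 (delta / B)) as T4.
  fold t in T1, T2.
  assert (T5 : t * B <= delta).
  { replace delta with (delta / B * B) by (field; lra).
    apply Rmult_le_compat_r; lra. }
  assert (T6 := Hterm t ltac:(lra) T5).
  assert (T7 : (Q + 1) * t <= P / 2).
  { replace (P / 2) with ((Q + 1) * (P / (2 * (Q + 1)))) by (field; lra).
    apply Rmult_le_compat_l; lra. }
  lra.
Qed.

Lemma flat_opp (g : R -> R) : flat_at_0 g -> flat_at_0 (fun t => - g t).
Proof.
  intros H J; destruct (H J) as [K [d [HK [Hd HJ]]]].
  exists K, d; repeat split; auto.
  intros t Ht; rewrite Rabs_Ropp; auto.
Qed.

Lemma dirichlet_expansion_opp (lam c : nat -> R) (g : R -> R) :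
  dirichlet_expansion lam c g ->
  dirichlet_expansion lam (fun n => - c n) (fun t => - g t).
Proof.
  intros H t Ht.
  apply (is_series_ext (fun n => opp (c n * exp (- (lam n * t))))).
  - intros n; unfold opp; simpl; ring.
  - apply (is_series_opp _ _ (H t Ht)).
Qed.

Definition eventually_one_signed (c : nat -> R) (m : nat) : Prop :=
  (forall n, (m <= n)%nat -> 0 <= c n) \/ (forall n, (m <= n)%nat -> c n <= 0).

Lemma flat_one_signed_tail_vanishes (lam c : nat -> R) (g : R -> R) (m : nat) :
  (forall i j, (i < j)%nat -> lam i < lam j) ->
  dirichlet_expansion lam c g -> flat_at_0 g -> eventually_one_signed c m ->
  forall n, (m <= n)%nat -> c n = 0.
Proof.
  intros Hlam Hser Hflat [Hc|Hc] n Hn.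
  - exact (flat_nonneg_tail_vanishes lam c g m Hlam Hser Hflat Hc n Hn).
  - enough (- c n = 0) by lra.
    apply (flat_nonneg_tail_vanishes lam (fun n => - c n) (fun t => - g t) m
             Hlam (dirichlet_expansion_opp _ _ _ Hser) (flat_opp _ Hflat));
      [|exact Hn].
    intros i Hi; specialize (Hc i Hi); lra.
Qed.

(** Descent on [m]: when all coefficients from [S m] on vanish, the tail from [m]
    on has the sign of its only remaining term [c m]. *)
Lemma flat_one_signed_zero (lam c : nat -> R) (g : R -> R) (m : nat) :
  (forall i j, (i < j)%nat -> lam i < lam j) ->
  dirichlet_expansion lam c g -> flat_at_0 g -> eventually_one_signed c m ->
  forall n, c n = 0.
Proof.
  intros Hlam Hser Hflat; induction m as [|m IH]; intros Hc.
  - intros n.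
    apply (flat_one_signed_tail_vanishes lam c g 0 Hlam Hser Hflat Hc); lia.
  - assert (Htail := flat_one_signed_tail_vanishes _ _ _ _ Hlam Hser Hflat Hc).
    refine (IH _).
    destruct (Rle_dec 0 (c m)); [left|right]; intros i Hi;
      (destruct (Nat.eq_dec i m) as [->|]; [lra|rewrite Htail by lia; lra]).
Qed.

(** * The imaginary axis and the cusp 0 *)

Lemma exp_neg_le_pow (u : R) (m : nat) :
  (0 < m)%nat -> 0 < u -> exp (- u) <= (INR m / u) ^ m.
Proof.
  intros Hm Hu.
  assert (Hm' : 0 < INR m) by (apply lt_0_INR; exact Hm).
  assert (Hq : 0 < u / INR m) by (apply Rdiv_lt_0_compat; lra).
  (* exp u = exp (u / m) ^ m >= (u / m) ^ m *)
  replace (INR m / u) with (/ (u / INR m)) by (field; lra).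
  rewrite exp_Ropp, pow_inv.
  apply Rinv_le_contravar; [apply pow_lt; exact Hq|].
  replace (exp u) with (exp (u / INR m) ^ m).
  - apply pow_incr; pose proof (exp_ineq1_le (u / INR m)); lra.
  - assert (H : forall j x, exp x ^ j = exp (INR j * x)).
    { intros j x; induction j as [|j IH].
      - simpl; rewrite Rmult_0_l, exp_0; reflexivity.
      - rewrite S_INR; simpl; rewrite IH, <- exp_plus; f_equal; ring. }
    rewrite H; f_equal; field; lra.
Qed.

Definition on_imaginary_axis (f : C -> C) (y : R) : R := Re (f (0, y)).

(** At z = i/t the matrix S = (0 -1; 1 0) gives -1/z = i t, so the decay of f|S
    at i oo reads t^k |f(i t)| <= A exp(-c/t), and exp(-c/t) is at most a constant
    times t^(k+J). *)
Lemma flat_of_decay_at_cusp_0 (k : nat) (f : C -> C) :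
  (0 < k)%nat ->
  exp_decay_at_i_infty (slash k f (Mat2 0 (-1) 1 0)) ->
  flat_at_0 (on_imaginary_axis f).
Proof.
  intros Hk [c [A [Y [Hc H]]]] J.
  set (m := (k + J)%nat).
  set (Y' := Rmax Y 1).
  assert (HY1 : 1 <= Y') by apply Rmax_r.
  assert (HY : Y <= Y') by apply Rmax_l.
  exists (Rabs A * (INR m / c) ^ m), (/ Y'); repeat split.
  - apply Rmult_le_pos; [apply Rabs_pos|apply pow_le].
    apply Rdiv_le_0_compat; [apply pos_INR|lra].
  - apply Rinv_0_lt_compat; lra.
  - intros t [Ht HtY].
    assert (Hinv : Y' <= / t).
    { rewrite <- (Rinv_inv Y'); apply Rinv_le_contravar; lra. }
    assert (Hit : 0 < / t) by lra.
    specialize (H (0, / t) Hit); simpl in H.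
    specialize (H ltac:(lra)).
    unfold slash, moebius in H; simpl in H.
    assert (Hz : (ZtoC 1 * (0, (/ t)%R) + ZtoC 0)%C = (0, (/ t)%R)).
    { unfold ZtoC, RtoC, Cmult, Cplus; simpl; f_equal; ring. }
    rewrite Hz in H; clear Hz.
    assert (Hw : ((ZtoC 0 * (0, (/ t)%R) + ZtoC (-1)) / (0, (/ t)%R))%C = (0, t)).
    { unfold ZtoC, RtoC, Cdiv, Cinv, Cmult, Cplus; simpl;
        f_equal; field; lra. }
    rewrite Hw in H; clear Hw.
    assert (Hn : Cmod (0, / t) = / t).
    { unfold Cmod; simpl.
      replace (0 * (0 * 1) + / t * (/ t * 1)) with ((/ t) ^ 2) by ring.
      rewrite <- Rsqr_pow2; apply sqrt_Rsqr; lra. }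
    assert (Hz0 : (0, / t) <> RtoC 0)
      by (intros E; rewrite E, Cmod_0 in Hn; lra).
    rewrite Cmod_mult, Cmod_inv, Cmod_pow, Hn, pow_inv, Rinv_inv in H
      by (apply Cpow_nz; exact Hz0).
    unfold on_imaginary_axis.
    eapply Rle_trans; [apply re_le_Cmod|].
    assert (Htk : 0 < t ^ k) by (apply pow_lt; exact Ht).
    apply Rmult_le_reg_l with (t ^ k); [exact Htk|].
    eapply Rle_trans; [exact H|].
    replace (t ^ k * (Rabs A * (INR m / c) ^ m * t ^ J))
      with (Rabs A * (INR m / (c * / t)) ^ m).
    + apply Rle_trans with (Rabs A * exp (- (c * / t))).
      * apply Rmult_le_compat_r; [apply Rlt_le, exp_pos|apply Rle_abs].
      * apply Rmult_le_compat_l; [apply Rabs_pos|].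
        apply exp_neg_le_pow; [unfold m; lia|apply Rmult_lt_0_compat; lra].
    + replace (INR m / (c * / t)) with (INR m / c * t) by (field; lra).
      rewrite Rpow_mult_distr.
      replace (t ^ m) with (t ^ k * t ^ J) by (symmetry; apply pow_add); ring.
Qed.

Lemma is_series_Re (u : nat -> C) (l : C) :
  @is_series C_AbsRing C_NormedModule u l -> is_series (fun n => Re (u n)) (Re l).
Proof.
  intros H.
  assert (Hsum : forall n, sum_n (fun n => Re (u n)) n = Re (sum_n u n)).
  { induction n as [|n IH]; [rewrite !sum_O; reflexivity|].
    rewrite !sum_Sn, IH; reflexivity. }
  unfold is_series.
  apply filterlim_ext with (fun n => Re (sum_n u n)); [intros n; auto|].
  apply filterlim_locally_ball_norm; intros eps.
  assert (H' := proj1 (filterlim_locally_ball_norm _ _) H eps).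
  revert H'; apply filter_imp; intros n.
  intros Hn; eapply Rle_lt_trans; [|exact Hn].
  exact (re_le_Cmod (minus (sum_n u n) l)).
Qed.

(** Since exp(2 pi i n z) is real and positive at z = i y, the real parts of the
    coefficients are the coefficients of the real part.  Index [n] stands for the
    Fourier coefficient of index [S n]. *)
Lemma fourier_on_imaginary_axis (f : C -> C) (a : nat -> C) :
  has_fourier_expansion f a ->
  dirichlet_expansion (fun n => 2 * PI * INR (S n)) (fun n => Re (a (S n)))
    (on_imaginary_axis f).
Proof.
  intros Ha t Ht.
  pose proof (is_series_Re _ _ (Ha (0, t) Ht)) as H.
  eapply is_series_ext; [|exact H]; intros n.
  cbv beta; set (r := INR (S n)).
  replace (RtoC (2 * PI) * Ci * RtoC r * (0, t))%C
    with (RtoC (- (2 * PI * r * t)))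
    by (unfold RtoC, Ci, Cmult; simpl; f_equal; ring).
  unfold Cexp; change (Im (RtoC (- (2 * PI * r * t)))) with 0.
  rewrite cos_0, sin_0; simpl.
  match goal with |- @eq _ ?x ?y => change (@eq R x y) end; unfold Re; simpl; ring.
Qed.

(** * Sign changes *)

Lemma zero_of_eventually_one_signed_fourier (k : nat) (f : C -> C)
  (a : nat -> C) (M : nat) :
  (0 < k)%nat ->
  exp_decay_at_i_infty (slash k f (Mat2 0 (-1) 1 0)) ->
  has_fourier_expansion f a ->
  (forall n, (1 <= n)%nat -> Im (a n) = 0) ->
  eventually_one_signed (fun n => Re (a (S n))) M ->
  forall z, upper_half_plane z -> f z = RtoC 0.
Proof.
  intros Hk Hdecay Ha Hreal Hsign z Hz.
  assert (Hflat := flat_of_decay_at_cusp_0 k f Hk Hdecay).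
  assert (Hinc : forall i j, (i < j)%nat ->
    2 * PI * INR (S i) < 2 * PI * INR (S j)).
  { intros i j Hij; pose proof PI_RGT_0.
    apply Rmult_lt_compat_l; [lra|apply lt_INR; lia]. }
  assert (Hzero := flat_one_signed_zero _ _ _ M Hinc
                     (fourier_on_imaginary_axis f a Ha) Hflat Hsign).
  assert (Ha0 : forall n, a (S n) = RtoC 0).
  { intros n; apply injective_projections;
      [exact (Hzero n)|apply (Hreal (S n)); lia]. }
  assert (Hpartial : forall n, sum_n (fun n => a (S n) *
    Cexp (RtoC (2 * PI) * Ci * RtoC (INR (S n)) * z))%C n = RtoC 0).
  { induction n as [|n IH].
    - rewrite sum_O, Ha0; apply Cmult_0_l.
    - rewrite sum_Sn, IH, Ha0, Cmult_0_l; apply Cplus_0_l. }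
  assert (Hlim := filterlim_ext _ _ Hpartial (Ha z Hz)).
  exact (@filterlim_locally_unique nat C_AbsRing C_NormedModule eventually _
           (fun _ => RtoC 0) (f z) (RtoC 0) Hlim (filterlim_const (RtoC 0))).
Qed.

Theorem proposition10 (k N : nat) (hk : (0 < k)%nat) (hN : (0 < N)%nat)
  (f : C -> C) (hf : second_order_cusp_form k N f)
  (hnz : exists z : C, upper_half_plane z /\ f z <> RtoC 0)
  (a : nat -> C) (ha : has_fourier_expansion f a)
  (hreal : forall n : nat, (1 <= n)%nat -> Im (a n) = 0%R) :
  changes_signs_infinitely_often (fun n : nat => Re (a n)).
Proof.
  destruct hnz as [z [Hz Hfz]].
  destruct hf as [_ [_ [_ hcusps]]].
  assert (hdecay := hcusps (Mat2 0 (-1) 1 0) eq_refl).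
  split; intros M; apply NNPP; intros Hno; apply Hfz;
    apply (zero_of_eventually_one_signed_fourier k f a M hk hdecay ha hreal);
    try exact Hz; [right|left]; intros n Hn; apply Rnot_lt_le; intros Hlt;
    apply Hno; exists (S n); repeat split; try lia; exact Hlt.
Qed.
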